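(* Let $\Delta$ be a simplicial complex on the vertex set $[n]$ with $\dim \Delta \ge 2$. Then $\Delta$ is a matroid if and only if $\Delta$ is connected and locally a matroid.
   Context: $[n]=\{1,\dots,n\}$. A simplicial complex $\Delta$ on $[n]$ is a family of subsets (faces) of $[n]$ closed under taking subsets and containing every $\{i\}$, $i\in[n]$; $\dim\Delta=\max\{|F|-1: F\in\Delta\}$. $\Delta$ is connected if the graph formed by its vertices and its one-dimensional faces is connected. For a face $G$, the link is $\operatorname{lk}_\Delta G=\{F\setminus G: G\subseteq F\in\Delta\}$. A simplicial complex $\Delta$ is a matroid if for all faces $F,G\in\Delta$ with $|F|>|G|$ there is $i\in F\setminus G$ with $G\cup\{i\}\in\Delta$. $\Delta$ is locally a matroid if $\operatorname{lk}_\Delta\{i\}$ is a matroid for every vertex $i$ of $\Delta$. *)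

(* Defs.v *)
From mathcomp Require Import all_boot all_order all_algebra.

Set Implicit Arguments.
Unset Strict Implicit.
Unset Printing Implicit Defensive.

Section SimplicialComplexes.
Variable T : finType.
Implicit Types (D : {set {set T}}) (F G : {set T}) (i j : T).

(* Every point of T is a vertex. The operations below make sense for any
   family of faces, since a link usually has fewer vertices than T. *)
Definition simplicial_complex D : Prop :=
  (forall F G, F \in D -> G \subset F -> G \in D) /\
  (forall i, [set i] \in D).

Definition vertices D : {set T} := [set i | [set i] \in D].

(* Integer-valued, as the complex {set0} has dimension -1. *)
Definition dimension D : int := ((\max_(F in D) #|F|)%:Z - 1)%R.

Definition edge D : rel T := fun i j => (i != j) && ([set i; j] \in D).

Definition connected D : Prop :=
  {in vertices D &, forall i j, connect (edge D) i j}.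

Definition link D G : {set {set T}} := [set F :\: G | F in D & G \subset F].

(* The exchange axiom only: to be used for families closed under taking
   subsets, such as simplicial complexes and their links. *)
Definition matroid D : Prop :=
  forall F G, F \in D -> G \in D -> #|G| < #|F| ->
  exists2 i, i \in F :\: G & i |: G \in D.

Definition locally_matroid D : Prop :=
  forall i, i \in vertices D -> matroid (link D [set i]).

End SimplicialComplexes.

(* Main.v *)
(* For the converse, the matroid property of the links gives exchange between
   any two faces with a common vertex. Connectedness propagates a face with
   three vertices to every vertex, so every edge lies in a triangle. Pushing
   triangles along a walk v - b - x - y yields an edge from v to x or to y; hence
   the diameter is at most 2, and every vertex is adjacent to an endpoint of
   every edge. Given |G| < |F| and g in G, this yields f in F with {g, f} a
   face, which extends inside F + g to a face H with |H| >= |F|; exchange between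
   H and G, which share g, then adds to G an element of F. *)
Require Import Defs.
From mathcomp Require Import all_boot all_order all_algebra.

Set Implicit Arguments.
Unset Strict Implicit.
Unset Printing Implicit Defensive.

Lemma connect_preserved (T : finType) (e : rel T) (P : T -> Prop) (x y : T) :
  (forall u w, e u w -> P u -> P w) -> connect e x y -> P x -> P y.
Proof.
move=> eP /connectP[p]; elim: p x => [|z p IHp] x /=; first by move=> _ ->.
by move=> /andP[xz pz] yE /(eP _ _ xz); apply: IHp.
Qed.

Section SimplicialComplex.
Variables (T : finType) (D : {set {set T}}).
Hypothesis complexD : simplicial_complex D.

Let faceS (F G : {set T}) : F \in D -> G \subset F -> G \in D.
Proof. exact: complexD.1. Qed.

Lemma mem_link1 (v : T) (F : {set T}) :
  (F \in link D [set v]) = (v \notin F) && (v |: F \in D).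
Proof.
apply/imsetP/andP => [[F']|[vF FD]].
  by rewrite inE sub1set => /andP[F'D vF'] ->; rewrite setD11 setD1K.
exists (v |: F); last by rewrite setU1K.
by rewrite inE FD sub1set setU11.
Qed.

(** Adding [v] to two faces of the link allows exchange in [D]; the element gained is not [v], which
    already lies in the smaller face. *)
Lemma matroid_locally : matroid D -> locally_matroid D.
Proof.
move=> exD v _ F G; rewrite !mem_link1 => /andP[vF FD] /andP[vG GD] ltGF.
have [|i] := exD _ _ FD GD; first by rewrite !cardsU1 vF vG.
rewrite !inE negb_or => /andP[/andP[iv iG] /predU1P[/eqP|iF]].
  by rewrite (negPf iv).
move=> iGD; exists i; first by rewrite inE iG.
by rewrite mem_link1 setUCA iGD !inE negb_or eq_sym iv vG.
Qed.

Lemma matroid_connected (F : {set T}) :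
  F \in D -> 1 < #|F| -> matroid D -> connected D.
Proof.
move=> FD F1 exD i j _ _.
have [-> //|neq_ij] := eqVneq i j.
have step u w : [set u; w] \in D -> connect (edge D) u w.
  by have [-> //|uw uwD] := eqVneq u w; apply: connect1; rewrite /edge uw.
(* Exchange against [F] gives [i] a neighbour [k]; exchange of [{k, i}] against [{j}] then joins [j]
   to [k] or to [i]. *)
have [||k] := exD F [set i] FD; rewrite ?cards1 ?complexD.2 // !inE.
move=> /andP[ki _] kiD.
have [||l] := exD _ [set j] kiD; rewrite ?cards1 ?cards2 ?ki ?complexD.2 // !inE.
move=> /andP[_ /orP[]/eqP-> ljD]; last exact: step.
by apply: (@connect_trans _ _ k); apply: step; rewrite // setUC.
Qed.

Section LocallyMatroid.
Hypothesis locD : locally_matroid D.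

(** Removing [v] puts both faces in its link and lowers both sizes by one; after exchange there, [v]
    is put back. *)
Lemma exchange_of_common_vertex (v : T) (F G : {set T}) :
    F \in D -> G \in D -> v \in F -> v \in G -> #|G| < #|F| ->
  exists2 i, i \in F :\: G & i |: G \in D.
Proof.
move=> FD GD vF vG ltGF.
have vV : v \in vertices D by rewrite inE complexD.2.
have [|||i] := locD vV (F := F :\ v) (G := G :\ v).
- by rewrite mem_link1 setD11 setD1K.
- by rewrite mem_link1 setD11 setD1K.
- by move: ltGF; rewrite (cardsD1 v) vG (cardsD1 v F) vF.
rewrite !inE negb_and negbK => /andP[/orP[->//|iG] /andP[iv iF]].
rewrite mem_link1 setUCA setD1K // => /andP[_ iGD].
by exists i; rewrite // inE iG.
Qed.

Hypothesis conD : connected D.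
Variable F0 : {set T}.
Hypotheses (F0D : F0 \in D) (F0_gt2 : 2 < #|F0|).

Lemma vertex_in_large_face (v : T) :
  exists F, [/\ F \in D, v \in F & 2 < #|F|].
Proof.
pose P u := exists F : {set T}, [/\ F \in D, u \in F & 2 < #|F|].
have [w wF0] : exists w, w \in F0 by apply/card_gt0P; apply: leq_trans F0_gt2.
have wv : connect (edge D) w v by apply: conD; rewrite inE complexD.2.
apply: (connect_preserved (P := P) _ wv); last by exists F0.
(* A large face at [a] enlarges the edge [{a, b}] to a face with three vertices, which contains
   [b]. *)
move=> a b /andP[ab abD] [F [FD aF F2]].
have [||i] := exchange_of_common_vertex FD abD aF; rewrite ?cards2 ?ab //.
  by rewrite !inE eqxx.
rewrite !inE => /andP[iab _] iD; exists (i |: [set a; b]); split=> //.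
  by rewrite !inE eqxx !orbT.
by rewrite cardsU1 cards2 ab !inE iab.
Qed.

Lemma edge_in_triangle (u v : T) : u != v -> [set u; v] \in D ->
  exists2 w, w \notin [set u; v] & w |: [set u; v] \in D.
Proof.
move=> uv uvD; have [F [FD uF F2]] := vertex_in_large_face u.
have [||w] := exchange_of_common_vertex FD uvD uF; rewrite ?cards2 ?uv //.
  by rewrite !inE eqxx.
by rewrite inE => /andP[wuv _] wD; exists w.
Qed.

Lemma triangle_adjacent (v c x y : T) :
    c \notin [set x; y] -> x != y ->
    c |: [set x; y] \in D -> [set c; v] \in D ->
  ([set v; x] \in D) || ([set v; y] \in D).
Proof.
move=> cxy xy cxyD cvD.
have [|||i] := exchange_of_common_vertex (v := c) cxyD cvD.
- by rewrite !inE eqxx.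
- by rewrite !inE eqxx.
(* [v] may equal [c], so [{c, v}] has one or two elements; the triangle is larger either way. *)
- by rewrite !cards2 cardsU1 cxy cards2 xy; case: (_ != _).
rewrite !inE => /andP[/norP[ic iv] /or3P[]/eqP iE iD]; subst i.
- by rewrite eqxx in ic.
- suff -> : [set v; x] \in D by [].
  by apply: faceS iD _; rewrite subUset !sub1set !inE !eqxx !orbT.
- suff -> : [set v; y] \in D by rewrite orbT.
  by apply: faceS iD _; rewrite subUset !sub1set !inE !eqxx !orbT.
Qed.

Lemma walk3_adjacent (v b x y : T) :
    [set v; b] \in D -> [set b; x] \in D -> [set x; y] \in D -> x != y ->
  ([set v; x] \in D) || ([set v; y] \in D).
Proof.
move=> vbD bxD xyD xy.
have [->|vb] := eqVneq v b; first by rewrite bxD.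
have [<-|bx] := eqVneq b x; first by rewrite vbD.
have [e evb evbD] := edge_in_triangle vb vbD.
have [|||i] := exchange_of_common_vertex (v := b) evbD bxD.
- by rewrite !inE eqxx !orbT.
- by rewrite !inE eqxx.
- by rewrite !cards2 cardsU1 evb cards2 vb bx.
rewrite !inE => /andP[/norP[ib ix]]; rewrite (negPf ib) orbF.
case/orP=> /eqP iE ibxD; subst i; last first.
  by rewrite (faceS ibxD) // subUset !sub1set !inE !eqxx !orbT.
(* The triangle on [v], [b] has been pushed to one on [b], [x] with the same third vertex; it is now
   pushed to [{x, y}]. The new third vertex [c] is that vertex or [b], and both share a face with
   [v]. *)
have [|||c] := exchange_of_common_vertex (v := x) ibxD xyD.
- by rewrite !inE eqxx !orbT.
- by rewrite !inE eqxx.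
- by rewrite !cards2 cardsU1 !inE (negPf ib) (negPf ix) cards2 xy bx.
rewrite inE => /andP[cxy cE] cxyD.
apply: (triangle_adjacent cxy xy cxyD).
move: cxy cE; rewrite !inE => /norP[/negPf-> _]; rewrite orbF.
case/orP=> /eqP->; last by rewrite setUC.
by apply: faceS evbD _; rewrite subUset !sub1set !inE !eqxx !orbT.
Qed.

Lemma diameter_le2 (v y : T) :
  exists2 b, [set v; b] \in D & [set b; y] \in D.
Proof.
pose P u := exists2 b, [set v; b] \in D & [set b; u] \in D.
have vy : connect (edge D) v y by apply: conD; rewrite inE complexD.2.
(* The midpoint may be an endpoint, since [{v, v}] is the face [{v}]. *)
apply: (connect_preserved (P := P) _ vy); last by exists v; rewrite setUid complexD.2.
move=> x z /andP[xz xzD] [b vbD bxD].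
have /orP[vx|vz] := walk3_adjacent vbD bxD xzD xz; first by exists x.
by exists z; rewrite // setUid complexD.2.
Qed.

Lemma adjacent_to_edge (v x y : T) : [set x; y] \in D -> x != y ->
  ([set v; x] \in D) || ([set v; y] \in D).
Proof. by have [b vbD bxD] := diameter_le2 v x; apply: walk3_adjacent bxD. Qed.

Lemma connected_locally_matroid : matroid D.
Proof.
move=> F G FD GD ltGF.
(* An empty [G] shares no vertex with any face, but any vertex of [F] can be added to it. *)
have [G0|[g gG]] := set_0Vmem G.
  have /card_gt0P[i iF] : 0 < #|F| by apply: leq_trans ltGF.
  by exists i; rewrite G0 ?setD0 // setU0 complexD.2.
have /card_gt1P[x [y [xF yF xy]]] : 1 < #|F|.
  by apply: leq_trans ltGF; rewrite ltnS; apply/card_gt0P; exists g.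
have xyD : [set x; y] \in D by apply: faceS FD _; rewrite subUset !sub1set xF.
have [f fF gfD] : exists2 f, f \in F & [set g; f] \in D.
  by case/orP: (adjacent_to_edge g xyD xy) => ?; [exists x | exists y].
pose P := [pred H : {set T} | [&& H \in D, [set g; f] \subset H
                                & H \subset g |: F]].
have P0 : P [set g; f].
  by rewrite /= gfD subxx subUset !sub1set !inE eqxx fF orbT.
case: (arg_maxnP (fun H : {set T} => #|H|) P0) => H /and3P[HD].
rewrite {1}subUset !sub1set => /andP[gH fH] HF Hmax.
(* Were [H] smaller than [F], exchange at the common vertex [f] would enlarge it within [g |: F],
   against maximality. *)
have leFH : #|F| <= #|H|.
  rewrite leqNgt; apply/negP => ltHF.
  have [i /setDP[iF iH] iHD] := exchange_of_common_vertex FD HD fF fH ltHF.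
  have := Hmax (i |: H); rewrite /= iHD subUset !sub1set !inE gH fH !orbT /=.
  rewrite subUset HF sub1set !inE iF orbT /= => /(_ isT).
  by rewrite cardsU1 iH add1n /= ltnn.
have [i /setDP[iH iG] iGD] :=
  exchange_of_common_vertex HD GD gH gG (leq_trans ltGF leFH).
(* [i] differs from [g], which is in [G], so it comes from [F]. *)
exists i => //; rewrite inE iG; move/subsetP/(_ _ iH): HF.
by case/setU1P=> // ig; rewrite ig gG in iG.
Qed.

End LocallyMatroid.
End SimplicialComplex.

Lemma dimension_ge2_face (T : finType) (D : {set {set T}}) :
  (2 <= dimension D)%R -> exists2 F, F \in D & 2 < #|F|.
Proof.
rewrite /dimension Num.Theory.lerBrDr => dimD; apply/exists_inP; move: dimD.
apply: contraLR => /exists_inPn noF; rewrite -Order.TotalTheory.ltNge.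
by rewrite ltz_nat ltnS; apply/bigmax_leqP => F /noF; rewrite -leqNgt.
Qed.

Theorem theorem2p7 (n : nat) (D : {set {set 'I_n}})
    (complexD : simplicial_complex D) (dimD : (2 <= dimension D)%R) :
  matroid D <-> connected D /\ locally_matroid D.
Proof.
have [F FD F_gt2] := dimension_ge2_face dimD.
split=> [exD|[conD locD]]; last exact: connected_locally_matroid FD F_gt2.
by split; [apply: matroid_connected FD (ltnW F_gt2) exD | apply: matroid_locally].
Qed.
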